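(* Let $\{D_n\}_{n\in\mathbb{N}}$ be a system of Dedekind domains, $D=\bigcup_{n\in\mathbb{N}}D_n$ and $M$ a maximal ideal of $D$. Then the following statements are equivalent. (1) $D_M$ is a DVR. (2) There exists $n\in\mathbb{N}$ such that $(M\cap D_n)(D_j)_{M\cap D_j}=(M\cap D_j)(D_j)_{M\cap D_j}$ for all $j\in\mathbb{N}$ with $j\ge n$. (3) There exists $n\in\mathbb{N}$ such that $M\cap D_n\nsubseteq (M\cap D_j)^2$ for all $j\in\mathbb{N}$ with $j\ge n$. In this case, $MD_M=(M\cap D_n)D_M$ (for $n$ as in (2) or (3)).
   Context: A system of Dedekind domains is a strictly increasing chain $D_1\subsetneq D_2\subsetneq D_3\subsetneq\cdots$ of Dedekind domains (each a subring of the next) such that: (i) each $D_j$ is not a field; (ii) for all $i<j$, each maximal ideal $P$ of $D_i$ survives in $D_j$, i.e. $PD_j\neq D_j$; (iii) for each $j\in\mathbb{N}$, each maximal ideal of $D_j$ contracts to a maximal ideal of $D_1$. Here $\mathbb{N}$ is the set of positive integers. A DVR is a principal ideal domain with exactly one nonzero maximal ideal. *)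

(* Defs.v *)
From mathcomp Require Export all_boot all_order all_algebra.
From mathcomp Require Export boolp classical_sets.

Set Implicit Arguments.
Unset Strict Implicit.
Unset Printing Implicit Defensive.

Import GRing.Theory.

Local Open Scope classical_set_scope.
Local Open Scope ring_scope.

(* All integral domains below are subrings [A : set K] of one arbitrary ambient
   field [K].  Their ideals, their fraction fields and their localizations are
   then subsets of [K] as well, so that contraction is plain intersection. *)
Section SubringsOfAField.
Variable K : fieldType.
Implicit Types A B I J P Q S : set K.

Definition is_subring A : Prop := GRing.subring_closed [in A].

Record is_ideal A I : Prop := IsIdeal {
  ideal_sub : I `<=` A;
  ideal0 : I 0;
  idealD : forall x y, I x -> I y -> I (x + y);
  idealM : forall a x, A a -> I x -> I (a * x)
}.

Definition ideal_gen A S : set K := smallest (is_ideal A) S.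

Definition ideal_mul A I J : set K := ideal_gen A [set x * y | x in I & y in J].

Definition ideal_sqr A I : set K := ideal_mul A I I.

Record is_prime_ideal A P : Prop := IsPrimeIdeal {
  prime_ideal : is_ideal A P;
  prime_proper : P <> A;
  prime_mul : forall x y, A x -> A y -> P (x * y) -> P x \/ P y
}.

Record is_maximal_ideal A P : Prop := IsMaximalIdeal {
  maximal_ideal : is_ideal A P;
  maximal_proper : P <> A;
  maximal_max : forall I, is_ideal A I -> P `<=` I -> I = P \/ I = A
}.

Definition is_subfield A : Prop :=
  is_subring A /\ (forall x, A x -> x != 0 -> A x^-1).

Definition fraction_field A : set K := [set a / b | a in A & b in A `\ 0].

Definition localization A P : set K := [set a / s | a in A & s in A `\` P].

Definition is_noetherian A : Prop :=
  forall I, is_ideal A I -> exists s : seq K, I = ideal_gen A [set` s].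

Definition integral_over A (x : K) : Prop :=
  exists p : {poly K}, [/\ p \is monic, p \is a polyOver [in A] & root p x].

Definition integrally_closed A : Prop :=
  forall x, fraction_field A x -> integral_over A x -> A x.

(* Fields count as Dedekind domains here. *)
Record is_dedekind A : Prop := IsDedekind {
  dedekind_subring : is_subring A;
  dedekind_noetherian : is_noetherian A;
  dedekind_integrally_closed : integrally_closed A;
  dedekind_prime_maximal :
    forall P, is_prime_ideal A P -> P <> [set 0] -> is_maximal_ideal A P
}.

Definition is_PID A : Prop :=
  is_subring A /\
  (forall I, is_ideal A I -> exists2 a, A a & I = ideal_gen A [set a]).

Definition is_DVR A : Prop :=
  is_PID A /\ (exists! Q : set K, is_maximal_ideal A Q /\ Q <> [set 0]).

(* The chain is numbered from 0: [D 0] is the smallest ring, D_1 on paper. *)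
Record dedekind_system (D : nat -> set K) : Prop := DedekindSystem {
  system_dedekind : forall j, is_dedekind (D j);
  system_chain : forall j, D j `<` D j.+1;
  system_not_field : forall j, ~ is_subfield (D j);
  system_survive : forall i j, (i < j)%N ->
    forall P, is_maximal_ideal (D i) P -> ideal_gen (D j) P <> D j;
  system_contract : forall j Q, is_maximal_ideal (D j) Q ->
    is_maximal_ideal (D 0%N) (Q `&` D 0%N)
}.

Definition stable_local_extension (D : nat -> set K) (M : set K) (n : nat) :
    Prop :=
  forall j, (n <= j)%N ->
    let L := localization (D j) (M `&` D j) in
    ideal_gen L (M `&` D n) = ideal_gen L (M `&` D j).

Definition never_in_square (D : nat -> set K) (M : set K) (n : nat) : Prop :=
  forall j, (n <= j)%N -> ~ (M `&` D n `<=` ideal_sqr (D j) (M `&` D j)).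

End SubringsOfAField.

(* Main.v *)
(* Write P_j for the contraction of M to D_j; survival and contraction of
   maximal ideals make every P_j a nonzero prime, so L_j = (D_j)_{P_j} is a DVR,
   with uniformizer p_j say, and L = U_M is the increasing union of the L_j.
   An element of P_n outside P_j^2 is a unit times p_j in L_j, so for a fixed n
   conditions (2) and (3) say the same thing.  If (2) holds for n, then p_n
   generates the maximal ideal of every L_j with j >= n, hence M L, and a
   factorization u p_n^k of an element in some L_j persists in L, so L is a DVR.
   Conversely, if M L is principal it is generated by some m in P_n; for x in
   P_j the quotient x / m lies in L, so m / x is not in the maximal ideal of the
   valuation ring L_j and x / m already lies in L_j. *)
Require Import Defs.
From mathcomp Require Import all_boot all_order all_algebra ring.
From mathcomp Require Import boolp classical_sets.

Set Implicit Arguments.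
Unset Strict Implicit.
Unset Printing Implicit Defensive.

Import GRing.Theory.

Local Open Scope classical_set_scope.
Local Open Scope ring_scope.

Section Subrings.
Variable K : fieldType.
Implicit Types (A B I J L M P Q S T : set K) (a b m p q s t x y z : K).

(** * Subrings, ideals and generated ideals *)

Section Closure.
Variable A : set K.
Hypothesis sA : is_subring A.

Lemma subring1 : A 1.
Proof. by case: sA; rewrite in_setE. Qed.

Lemma subringB x y : A x -> A y -> A (x - y).
Proof.
by case: sA => _ sB _ Ax Ay; have := sB x y; rewrite !in_setE; apply.
Qed.

Lemma subringM x y : A x -> A y -> A (x * y).
Proof.
by case: sA => _ _ sM Ax Ay; have := sM x y; rewrite !in_setE; apply.
Qed.

Lemma subring0 : A 0.
Proof. by rewrite -(subrr 1); apply: subringB; exact: subring1. Qed.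

Lemma subringN x : A x -> A (- x).
Proof.
by move=> Ax; rewrite -sub0r; apply: subringB => //; exact: subring0.
Qed.

Lemma subringD x y : A x -> A y -> A (x + y).
Proof.
by move=> Ax Ay; rewrite -(opprK y); apply: subringB => //; exact: subringN.
Qed.

Lemma subringX n x : A x -> A (x ^+ n).
Proof.
move=> Ax; elim: n => [|n IH]; first by rewrite expr0; exact: subring1.
by rewrite exprS; exact: subringM.
Qed.

Lemma polyOver_subring (p : {poly K}) :
  (p \is a polyOver [in A]) <-> (forall i, A p`_i).
Proof.
split=> [/allP Ap i|Ap].
  have [ltip|leip] := ltnP i (size p).
    by have := Ap _ (mem_nth 0 ltip); rewrite in_setE.
  by rewrite nth_default //; exact: subring0.
by apply/(all_nthP 0) => i _; rewrite in_setE.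
Qed.

Lemma subring_ideal : is_ideal A A.
Proof.
by split=> //; [exact: subring0 | exact: subringD | exact: subringM].
Qed.

Lemma zero_ideal : is_ideal A [set 0].
Proof.
split=> [x -> | | x y -> -> | a x _ ->] //=; first exact: subring0.
  by rewrite addr0.
by rewrite mulr0.
Qed.

Lemma principal_ideal a : A a -> is_ideal A [set a * y | y in A].
Proof.
move=> Aa; split.
- by move=> _ [y Ay <-]; exact: subringM.
- by exists 0; [exact: subring0 | rewrite mulr0].
- move=> _ _ [y Ay <-] [z Az <-].
  by exists (y + z); [exact: subringD | rewrite mulrDr].
- by move=> b _ Ab [y Ay <-]; exists (b * y); [exact: subringM | ring].
Qed.

Lemma ideal_unit I : is_ideal A I -> I 1 -> I = A.
Proof.
move=> iI I1; apply/seteqP; split; first exact: ideal_sub iI.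
by move=> x Ax; rewrite -(mulr1 x); exact: idealM iI _ _ Ax I1.
Qed.

Lemma proper_ideal1 I : is_ideal A I -> I <> A -> ~ I 1.
Proof. by move=> iI nIA /(ideal_unit iI). Qed.

Lemma ideal_gen_min S I : is_ideal A I -> S `<=` I -> ideal_gen A S `<=` I.
Proof. exact: smallest_sub. Qed.

Lemma sub_ideal_gen S : S `<=` ideal_gen A S.
Proof. exact: sub_gen_smallest. Qed.

Lemma ideal_gen_ideal S : S `<=` A -> is_ideal A (ideal_gen A S).
Proof.
move=> SA; split.
- by apply: ideal_gen_min => //; exact: subring_ideal.
- by move=> I [iI _]; exact: ideal0 iI.
- by move=> x y Sx Sy I SI; apply: (idealD SI.1); [exact: Sx | exact: Sy].
- by move=> a x Aa Sx I SI; apply: (idealM SI.1) => //; exact: Sx.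
Qed.

Lemma ideal_gen1 a : A a -> ideal_gen A [set a] = [set a * y | y in A].
Proof.
move=> Aa; apply/seteqP; split.
  apply: ideal_gen_min; first exact: principal_ideal.
  by move=> _ ->; exists 1; [exact: subring1 | rewrite mulr1].
have aA : [set a] `<=` A by move=> _ ->.
move=> _ [y Ay <-]; rewrite mulrC.
exact: (idealM (ideal_gen_ideal aA) Ay (sub_ideal_gen (erefl a))).
Qed.

End Closure.

(** * Contraction and extension of ideals between subrings *)

Lemma ideal_contract A B I : is_subring A -> A `<=` B -> is_ideal B I ->
  is_ideal A (I `&` A).
Proof.
move=> sA AB iI; split.
- by move=> x [].
- by split; [exact: ideal0 iI | exact: subring0].
- move=> x y [Ix Ax] [Iy Ay]; split; last exact: subringD.
  exact: idealD iI _ _ Ix Iy.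
- move=> a x Aa [Ix Ax]; split; last exact: subringM.
  exact: idealM iI _ _ (AB _ Aa) Ix.
Qed.

Lemma prime_contract A B P : is_subring A -> A `<=` B -> is_prime_ideal B P ->
  is_prime_ideal A (P `&` A).
Proof.
move=> sA AB [iP nP mulP]; split; first exact: ideal_contract AB iP.
- move=> PA; apply: nP.
  have [P1 _] : (P `&` A) 1 by rewrite PA; exact: subring1.
  apply/seteqP; split; first exact: ideal_sub iP.
  by move=> x Bx; rewrite -(mulr1 x); exact: idealM iP _ _ Bx P1.
- move=> x y Ax Ay [Pxy _].
  by case: (mulP x y) => //; [exact: AB.. | left | right].
Qed.

Lemma ideal_gen_ringS A B S : is_subring A -> is_subring B -> A `<=` B ->
  S `<=` A -> ideal_gen A S `<=` ideal_gen B S.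
Proof.
move=> sA sB AB SA x Sx.
have iB : is_ideal B (ideal_gen B S) by apply: ideal_gen_ideal => // y /SA/AB.
apply: (ideal_gen_min (ideal_contract sA AB iB) _ Sx).1 => y Sy.
by split; [exact: sub_ideal_gen | exact: SA].
Qed.

Lemma ideal_gen_setS A S T : is_subring A -> S `<=` T -> T `<=` A ->
  ideal_gen A S `<=` ideal_gen A T.
Proof.
by move=> sA ST TA; apply: sub_smallest2r => //; exact: ideal_gen_ideal.
Qed.

(** A principal generator survives every enlargement of the ring. This carries the uniformizer of
    one localization of the chain to the later ones and to their union. *)
Lemma principal_ringS A B S p : is_subring A -> is_subring B -> A `<=` B ->
  S `<=` A -> ideal_gen A S = [set p * y | y in A] ->
  ideal_gen B S = [set p * y | y in B].
Proof.
move=> sA sB AB SA Sp.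
have Gp : ideal_gen A S p.
  by rewrite Sp; exists 1; [exact: subring1 | rewrite mulr1].
have iA := ideal_gen_ideal sA SA.
have iB : is_ideal B (ideal_gen B S) by apply: ideal_gen_ideal => // y /SA/AB.
apply/seteqP; split.
  apply: ideal_gen_min.
    by apply: principal_ideal => //; exact/AB/(ideal_sub iA).
  move=> x /(sub_ideal_gen (A := A)); rewrite Sp => -[y Ay <-].
  by exists y => //; exact: AB.
move=> _ [y By <-]; rewrite mulrC; apply: (idealM iB) => //.
exact: ideal_gen_ringS AB SA _ Gp.
Qed.

(** * Chain conditions and almost integral elements *)

Lemma seq_in_chain (F : nat -> set K) (s : seq K) :
  (forall i j, (i <= j)%N -> F i `<=` F j) -> [set` s] `<=` \bigcup_n F n ->
  exists n, [set` s] `<=` F n.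
Proof.
move=> Fle; elim: s => [|x s IH] sF; first by exists 0%N.
have [|n sn] := IH; first by move=> y sy; apply: sF; rewrite /= inE sy orbT.
have [|i _ Fx] := sF x; first by rewrite /= mem_head.
exists (maxn i n) => y /=; rewrite inE => /orP[/eqP-> | sy].
  exact: Fle (leq_maxl _ _) _ Fx.
exact: Fle (leq_maxr _ _) _ (sn _ sy).
Qed.

Lemma chain_ideal A (F : nat -> set K) : (forall n, is_ideal A (F n)) ->
  (forall i j, (i <= j)%N -> F i `<=` F j) -> is_ideal A (\bigcup_n F n).
Proof.
move=> iF Fle; split.
- by move=> x [n _]; exact: ideal_sub (iF n) _.
- by exists 0%N => //; exact: ideal0 (iF _).
- move=> x y [i _ Fx] [j _ Fy]; exists (maxn i j) => //.
  apply: (idealD (iF _)); first exact: Fle (leq_maxl _ _) _ Fx.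
  exact: Fle (leq_maxr _ _) _ Fy.
- by move=> a x Aa [n _ Fx]; exists n => //; exact: idealM (iF n) _ _ Aa Fx.
Qed.

(** The union of the chain is an ideal, and its finitely many generators already lie in one
    member. *)
Lemma noetherian_stationary A (F : nat -> set K) : is_noetherian A ->
  (forall n, is_ideal A (F n)) -> (forall i j, (i <= j)%N -> F i `<=` F j) ->
  exists n, \bigcup_k F k `<=` F n.
Proof.
move=> nA iF Fle; have [s Fs] := nA _ (chain_ideal iF Fle).
have [|n sn] := @seq_in_chain F s Fle.
  by rewrite Fs; exact: sub_ideal_gen.
by exists n; rewrite Fs; exact: ideal_gen_min.
Qed.

(** Without a maximal member, choice gives a strictly larger member for each one; iterating it
    builds a chain that never becomes stationary. *)
Lemma noetherian_max A (F : set (set K)) : is_noetherian A ->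
  (forall I, F I -> is_ideal A I) -> F !=set0 ->
  exists2 I, F I & forall J, F J -> I `<=` J -> J = I.
Proof.
move=> nA iF [I0 FI0]; apply: contrapT => nomax.
have next (I : {I | F I}) : exists J : {J | F J},
    sval I `<=` sval J /\ sval J <> sval I.
  case: I => I FI /=; apply: contrapT => noJ; apply: nomax.
  exists I => // J FJ IJ.
  by apply: contrapT => nJI; apply: noJ; exists (exist _ J FJ).
have [g gP] := choice next.
pose G n := sval (iter n g (exist _ I0 FI0)).
have Gle i j : (i <= j)%N -> G i `<=` G j.
  move=> /subnK <-; elim: (j - i)%N => [|k IH] //.
  by rewrite addSn => x /IH; exact: (gP _).1.
have [|n Gn] := noetherian_stationary nA _ Gle.
  by move=> n; apply: iF; exact: svalP.
apply: (gP (iter n g (exist _ I0 FI0))).2; apply/seteqP; split.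
  by move=> x Gx; apply: Gn; exists n.+1.
exact: (gP _).1.
Qed.

(** The values [q.[x] * a] with [size q <= n] form an ascending chain of ideals [J n] of [A]. Where
    it stops, [x ^+ n * a] equals some [q.[x] * a], and cancelling [a] leaves a monic equation for
    [x]. *)
Lemma almost_integral A a x : is_subring A -> is_noetherian A -> a != 0 ->
  (forall k, A (x ^+ k * a)) -> integral_over A x.
Proof.
move=> sA nA a0 Axa.
pose J n := [set q.[x] * a | q in
  [set q : {poly K} | (forall i, A q`_i) /\ (size q <= n)%N]].
have [||n Jn] := @noetherian_stationary A J nA.
- move=> n; split.
  + move=> _ [q [Aq _] <-]; rewrite horner_coef mulr_suml.
    elim/big_ind: _ => [|y z|i _]; [exact: subring0 | exact: subringD |].
    by rewrite -mulrA; exact: subringM.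
  + exists 0; last by rewrite horner0 mul0r.
    by split=> [i|]; rewrite ?size_poly0 // coef0; exact: subring0.
  + move=> _ _ [q [Aq sq] <-] [r [Ar sr] <-]; exists (q + r).
      split=> [i|]; first by rewrite coefD; exact: subringD.
      by rewrite (leq_trans (size_polyD _ _)) // geq_max sq.
    by rewrite hornerD mulrDl.
  + move=> b _ Ab [q [Aq sq] <-]; exists (b *: q).
      split=> [i|]; first by rewrite coefZ; exact: subringM.
      exact: leq_trans (size_scale_leq _ _) sq.
    by rewrite hornerZ mulrA.
- move=> i j leij _ [q [Aq sq] <-]; exists q => //; split=> //.
  exact: leq_trans leij.
have [|q [Aq sq] /(mulIf a0) qx] := Jn (x ^+ n * a).
  exists n.+1 => //; exists 'X^n; last by rewrite hornerXn.
  split=> [i|]; last by rewrite size_polyXn.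
  by rewrite coefXn; case: eqP => _; [exact: subring1 | exact: subring0].
(* The bound [size q <= n] keeps [q] below degree [n], so the difference is monic. *)
exists ('X^n - q); split.
- by rewrite monicE lead_coefDl ?lead_coefXn // size_polyN size_polyXn ltnS.
- apply/polyOver_subring => // i; rewrite coefB coefXn.
  by apply: subringB => //; case: eqP => _; [exact: subring1 | exact: subring0].
- by rewrite /root !hornerE qx subrr.
Qed.

(** * Maximal ideals *)

Lemma maximal_bezout A M x : is_subring A -> is_maximal_ideal A M ->
  A x -> ~ M x -> exists m a, [/\ M m, A a & m + a * x = 1].
Proof.
move=> sA [iM nM maxM] Ax nMx.
(* The ideal M + Ax contains M and also [x], so maximality leaves only the whole ring. *)
pose I := [set m + a * x | m in M & a in A].
have iI : is_ideal A I.
  split.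
  - move=> _ [m Mm [a Aa <-]]; apply: subringD => //; last exact: subringM.
    exact: ideal_sub iM _ Mm.
  - exists 0; first exact: ideal0 iM.
    by exists 0; [exact: subring0 | rewrite mul0r addr0].
  - move=> _ _ [m Mm [a Aa <-]] [n Mn [b Ab <-]].
    exists (m + n); first exact: idealD iM _ _ Mm Mn.
    by exists (a + b); [exact: subringD | ring].
  - move=> c _ Ac [m Mm [a Aa <-]].
    exists (c * m); first exact: idealM iM _ _ Ac Mm.
    by exists (c * a); [exact: subringM | ring].
have MI : M `<=` I.
  move=> m Mm; exists m => //.
  by exists 0; [exact: subring0 | rewrite mul0r addr0].
have [IM|IA] := maxM _ iI MI.
  case: nMx; rewrite -IM; exists 0; first exact: ideal0 iM.
  by exists 1; [exact: subring1 | rewrite mul1r add0r].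
have [m Mm [a Aa max1]] : I 1 by rewrite IA; exact: subring1.
by exists m, a.
Qed.

Lemma maximal_prime A M : is_subring A -> is_maximal_ideal A M ->
  is_prime_ideal A M.
Proof.
move=> sA maxM; have [iM nM _] := maxM; split=> // x y Ax Ay Mxy.
have [Mx|nMx] := EM (M x); [by left | right].
have [m [a [Mm Aa max1]]] := maximal_bezout sA maxM Ax nMx.
(* With m + ax = 1, one has y = ym + a(xy), and both terms lie in [M]. *)
rewrite -(mul1r y) -max1 mulrDl mulrC -mulrA.
apply: (idealD iM); first exact: idealM iM _ _ Ay Mm.
exact: idealM iM _ _ Aa Mxy.
Qed.

(** The multiples of a nonzero [x] form an ideal larger than zero, hence the unit ideal, so [x] has
    an inverse in [A]. *)
Lemma maximal0_subfield A : is_subring A -> is_maximal_ideal A [set 0] ->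
  is_subfield A.
Proof.
move=> sA [i0 n0 max0]; split=> // x Ax x0.
have [|I0|IA] := max0 _ (principal_ideal sA Ax).
- by move=> _ ->; exists 0; [exact: subring0 | rewrite mulr0].
- have : [set x * y | y in A] x by exists 1; [exact: subring1 | rewrite mulr1].
  by rewrite I0 => /eqP; rewrite (negPf x0).
- have [y Ay xy1] : [set x * y | y in A] 1 by rewrite IA; exact: subring1.
  by rewrite -[x^-1]mulr1 -xy1 mulKf.
Qed.

(** * Local rings with a given ideal of nonunits *)

Record local_ring (L m : set K) : Prop := LocalRing {
  local_subring : is_subring L;
  local_ideal : is_ideal L m;
  local_proper : ~ m 1;
  local_unit : forall x, L x -> ~ m x -> L x^-1
}.

Section LocalRing.
Variables L m : set K.
Hypothesis Lm : local_ring L m.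
Let sL := local_subring Lm.
Let im := local_ideal Lm.

Lemma local_nonunit x : m x -> x != 0 -> ~ L x^-1.
Proof.
move=> mx x0 Lx; apply: (local_proper Lm); rewrite -(mulVf x0).
exact: idealM im _ _ Lx mx.
Qed.

Lemma local_ideal_sub I : is_ideal L I -> ~ I 1 -> I `<=` m.
Proof.
move=> iI nI1 x Ix; apply: contrapT => nmx.
have [x0|x0] := eqVneq x 0; first by apply: nmx; rewrite x0; exact: ideal0 im.
apply: nI1; rewrite -(mulVf x0); apply: (idealM iI) => //.
by apply: (local_unit Lm) => //; exact: ideal_sub iI _ Ix.
Qed.

Lemma local_maximal : is_maximal_ideal L m.
Proof.
split=> //.
  by move=> mL; apply: (local_proper Lm); rewrite mL; exact: subring1.
move=> I iI mI; have [I1|nI1] := EM (I 1); first by right; exact: ideal_unit.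
by left; apply/seteqP; split=> //; exact: local_ideal_sub.
Qed.

Lemma local_maximal_unique Q : is_maximal_ideal L Q -> Q = m.
Proof.
move=> [iQ nQ maxQ]; have Qm := local_ideal_sub iQ (proper_ideal1 iQ nQ).
have [-> //|mL] := maxQ _ im Qm.
by case: (local_proper Lm); rewrite mL; exact: subring1.
Qed.

(** * Uniformizers and discrete valuations *)

Section Uniformizer.
Variable p : K.
Hypothesis p0 : p != 0.
Hypothesis mp : m = [set p * y | y in L].

Lemma uniformizer_mem : m p.
Proof. by rewrite mp; exists 1; [exact: subring1 | rewrite mulr1]. Qed.

Lemma uniformizer_ring : L p.
Proof. exact: ideal_sub im _ uniformizer_mem. Qed.

(** In a local ring the factor [u] is a unit, so [k] plays the role of the [p]-adic valuation of
    [x]. *)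
Definition has_valuation : Prop :=
  forall x, L x -> x != 0 -> exists k u, [/\ L u, ~ m u & x = u * p ^+ k].

(** An [x] without a factorization can be divided by [p] forever. Then [p^-1] is almost integral,
    hence integral, hence in [L], although [p] is a nonunit. *)
Lemma noetherian_valuation : is_noetherian L -> integrally_closed L ->
  has_valuation.
Proof.
move=> nL icL x Lx x0; apply: contrapT => nux.
have Lk k : L (p^-1 ^+ k * x).
  elim: k => [|k IH]; first by rewrite expr0 mul1r.
  have : m (p^-1 ^+ k * x).
    apply: contrapT => nm; apply: nux; exists k, (p^-1 ^+ k * x); split=> //.
    by rewrite mulrC mulrA exprVn mulfV ?mul1r // expf_neq0.
  by rewrite mp => -[y Ly py]; rewrite exprS -mulrA -py mulKf.
apply: (local_nonunit uniformizer_mem p0).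
apply: icL; last exact: almost_integral Lk.
exists 1; first exact: subring1.
exists p; last by rewrite mul1r.
by split; [exact: uniformizer_ring | exact/eqP].
Qed.

Hypothesis val : has_valuation.

(** The exponents of [x] and [y] are compared; in the strict case a spare factor [p] puts [y / x] in
    [m]. *)
Lemma valuation_total x y : L x -> L y -> y != 0 ->
  L (x / y) \/ m (y / x).
Proof.
move=> Lx Ly y0; have [->|x0] := eqVneq x 0.
  by left; rewrite mul0r; exact: subring0.
have [k [u [Lu nmu xe]]] := val Lx x0; have [l [v [Lv nmv ye]]] := val Ly y0.
have Lui := local_unit Lm Lu nmu; have Lvi := local_unit Lm Lv nmv.
have u0 : u != 0 by apply: contra_notN nmu => /eqP->; exact: ideal0 im.
have v0 : v != 0 by apply: contra_notN nmv => /eqP->; exact: ideal0 im.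
have [lelk|ltkl] := leqP l k.
  left; have -> : x / y = u * v^-1 * p ^+ (k - l).
    rewrite xe ye -{1}(subnK lelk) exprD; field.
    by rewrite v0 expf_neq0.
  do !apply: subringM => //; apply: subringX => //; exact: uniformizer_ring.
right; have -> : y / x = v * u^-1 * p ^+ (l - k.+1) * p.
  rewrite xe ye -{1}(subnK ltkl) exprD exprS; field.
  by rewrite u0 expf_neq0.
apply: (idealM im); last exact: uniformizer_mem.
do !apply: subringM => //; apply: subringX => //; exact: uniformizer_ring.
Qed.

(** A nonzero ideal contains some power of [p], and the least such power generates it. *)
Lemma valuation_DVR : is_DVR L.
Proof.
split; last first.
  exists m; split; last by move=> Q [/local_maximal_unique->].
  split; first exact: local_maximal.
  by move=> mE; have := uniformizer_mem; rewrite mE => /eqP; rewrite (negPf p0).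
split=> // I iI.
have [I0|nI0] := EM (I `<=` [set 0]).
  exists 0; first exact: subring0.
  apply/seteqP; split=> [x /I0->|]; first exact: sub_ideal_gen.
  by apply: ideal_gen_min => // _ ->; exact: ideal0 iI.
(* Membership is turned into a boolean so that [ex_minnP] can pick the least exponent. *)
pose V k := `[<I (p ^+ k)>].
have IV x : I x -> x != 0 -> exists k u, [/\ L u, I (p ^+ k) & x = u * p ^+ k].
  move=> Ix x0; have [k [u [Lu nmu xe]]] := val (ideal_sub iI Ix) x0.
  exists k, u; split=> //.
  have u0 : u != 0 by apply: contra_notN nmu => /eqP->; exact: ideal0 im.
  rewrite -[p ^+ k](mulKf u0) -xe; apply: (idealM iI) => //.
  exact: local_unit Lm _ Lu nmu.
have exV : exists k, V k.
  apply: contrapT => noV; apply: nI0 => x Ix; apply: contrapT => /eqP x0.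
  have [k [u [_ Ip _]]] := IV x Ix x0.
  by apply: noV; exists k; exact/asboolP.
have [k /asboolP Ik mink] := ex_minnP exV.
have Lk : L (p ^+ k) by exact: ideal_sub iI _ Ik.
exists (p ^+ k) => //; rewrite ideal_gen1 //.
apply/seteqP; split=> [x Ix|_ [y Ly <-]]; last first.
  by rewrite mulrC; exact: idealM iI _ _ Ly Ik.
have [->|x0] := eqVneq x 0.
  by exists 0; [exact: subring0 | rewrite mulr0].
have [l [u [Lu Il ->]]] := IV x Ix x0.
have lekl : (k <= l)%N by apply: mink; exact/asboolP.
exists (u * p ^+ (l - k)); last by rewrite mulrCA -exprD subnKC.
by apply: subringM => //; apply: subringX => //; exact: uniformizer_ring.
Qed.

End Uniformizer.

(* For [0 != a] in [m], a maximal proper ideal [(aL : b)] is prime, hence is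
   [m]; then [c = b / a] is not in [L] but [c m] lies in [L].  As [c] is not
   integral, [c m] is not contained in [m], so [c p] is a unit for some [p]. *)
Lemma local_uniformizer : is_noetherian L -> integrally_closed L ->
  (exists2 a, m a & a != 0) ->
  (forall Q, is_prime_ideal L Q -> Q <> [set 0] -> m `<=` Q) ->
  exists2 p, p != 0 & m = [set p * y | y in L].
Proof.
move=> nL icL [a ma a0] prL.
have La := ideal_sub im ma.
pose aL := [set a * y | y in L].
have iaL : is_ideal L aL by exact: principal_ideal.
pose C b := [set x | L x /\ aL (x * b)].
have iC b : is_ideal L (C b).
  split.
  - by move=> x [].
  - by split; [exact: subring0 | rewrite mul0r; exact: ideal0 iaL].
  - move=> x y [Lx xb] [Ly yb]; split; first exact: subringD.
    by rewrite mulrDl; exact: idealD iaL _ _ xb yb.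
  - move=> y x Ly [Lx xb]; split; first exact: subringM.
    by rewrite -mulrA; exact: idealM iaL _ _ Ly xb.
have naL1 : ~ aL 1.
  move=> [y Ly ay]; apply: (local_proper Lm); rewrite -ay mulrC.
  exact: idealM im _ _ Ly ma.
have [||_ [b [Lb nb] <-] maxb] :=
    @noetherian_max L [set C b | b in [set b | L b /\ ~ aL b]] nL.
- by move=> _ [b _ <-].
- by exists (C 1), 1 => //; split=> //; exact: subring1.
have mb : m `<=` C b.
  apply: prL; last first.
    move=> C0; have : C b a by split=> //; exists b.
    by rewrite C0 => /eqP; rewrite (negPf a0).
  split=> //.
    move=> CL; apply: nb; have : C b 1 by rewrite CL; exact: subring1.
    by case; rewrite mul1r.
  move=> x y Lx Ly [_ xyb]; have [xb|nxb] := EM (aL (x * b)); [by left | right].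
  (* Since [x * b] is not in [aL], the larger ideal [C (x * b)] is again in the family; maximality
     makes it equal to [C b], and it contains [y]. *)
  rewrite -(maxb (C (x * b))); first by split=> //; rewrite mulrA [y * x]mulrC.
    by exists (x * b) => //; split=> //; exact: subringM.
  move=> z [Lz zb]; split=> //; rewrite mulrCA; exact: idealM iaL _ _ Lx zb.
pose c := b / a.
have nc : ~ L c by move=> Lc; apply: nb; exists c => //; rewrite /c; field.
have cm x : m x -> L (c * x).
  move=> /mb[_ [y Ly ay]]; have -> // : c * x = y.
  by apply: (mulfI a0); rewrite ay /c; field.
have [p mp ncp] : exists2 p, m p & ~ m (c * p).
  apply: contrapT => nop; apply: nc; apply: icL.
    by exists b => //; exists a => //; split=> //; exact/eqP.
  (* If multiplication by [c] maps [m] into itself, every [c ^+ k * a] stays in [m], so [c] is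
     almost integral. *)
  apply: (@almost_integral L a) => // k; apply: (ideal_sub im).
  elim: k => [|k IH]; first by rewrite expr0 mul1r.
  rewrite exprS -mulrA; apply: contrapT => nm; apply: nop.
  by exists (c ^+ k * a).
have cp0 : c * p != 0 by apply: contra_notN ncp => /eqP->; exact: ideal0 im.
have p0 : p != 0 by apply: contra cp0 => /eqP->; rewrite mulr0.
have c0 : c != 0 by apply: contra cp0 => /eqP->; rewrite mul0r.
exists p => //; apply/seteqP; split=> [x mx|_ [y Ly <-]]; last first.
  by rewrite mulrC; exact: idealM im _ _ Ly mp.
(* Here [c * x] lies in [L] and [c * p] is a unit of [L], so the quotient x / p lies in [L]. *)
exists (c * x / (c * p)); last by field; rewrite p0.
by apply: subringM => //; [exact: cm | apply: (local_unit Lm) => //; exact: cm].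
Qed.

End LocalRing.

(** * Localization at a prime ideal *)

Definition extension A P I : set K := [set a / s | a in I & s in A `\` P].

Section Localization.
Variables A P : set K.
Hypothesis sA : is_subring A.
Hypothesis prP : is_prime_ideal A P.
Let iP := prime_ideal prP.
Let L := localization A P.

Lemma prime_proper1 : ~ P 1.
Proof. exact: proper_ideal1 iP (prime_proper prP). Qed.

Lemma denom1 : (A `\` P) 1.
Proof. by split; [exact: subring1 | exact: prime_proper1]. Qed.

Lemma denomM s t : (A `\` P) s -> (A `\` P) t -> (A `\` P) (s * t).
Proof.
move=> [As nPs] [At nPt]; split; first exact: subringM.
by case/(prime_mul prP As At).
Qed.

Lemma denom_neq0 s : (A `\` P) s -> s != 0.
Proof. by case=> _; apply: contra_notN => /eqP->; exact: ideal0 iP. Qed.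

Lemma localization_subring : is_subring L.
Proof.
split=> [|x y|x y]; rewrite ?in_setE.
- exists 1; first exact: subring1.
  by exists 1; [exact: denom1 | rewrite divr1].
- move=> [a Aa [s As <-]] [b Ab [t At <-]].
  have s0 := denom_neq0 As; have t0 := denom_neq0 At.
  exists (a * t - b * s).
    apply: subringB => //; apply: subringM => //; first exact: At.1.
    exact: As.1.
  by exists (s * t); [exact: denomM | field; rewrite s0 t0].
- move=> [a Aa [s As <-]] [b Ab [t At <-]].
  have s0 := denom_neq0 As; have t0 := denom_neq0 At.
  exists (a * b); first exact: subringM.
  by exists (s * t); [exact: denomM | field; rewrite s0 t0].
Qed.

Let sL := localization_subring.

Lemma sub_localization : A `<=` L.
Proof.
by move=> x Ax; exists x => //; exists 1; [exact: denom1 | rewrite divr1].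
Qed.

Lemma denom_inv s : (A `\` P) s -> L s^-1.
Proof.
by move=> As; exists 1; [exact: subring1 | exists s; rewrite ?mul1r].
Qed.

(** Common denominators make the fractions with numerator in [I] closed under addition, so single
    fractions already exhaust the generated ideal. *)
Lemma ideal_gen_extension I : is_ideal A I ->
  ideal_gen L I = extension A P I.
Proof.
move=> iI; apply/seteqP; split; last first.
  move=> _ [a Ia [s As <-]]; rewrite mulrC.
  apply: idealM (denom_inv As) (sub_ideal_gen Ia).
  apply: ideal_gen_ideal => // x Ix.
  exact/sub_localization/(ideal_sub iI).
apply: ideal_gen_min; last first.
  by move=> x Ix; exists x => //; exists 1; [exact: denom1 | rewrite divr1].
split.
- move=> _ [a Ia [s As <-]]; exists a; first exact: ideal_sub iI _ Ia.
  by exists s.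
- exists 0; first exact: ideal0 iI.
  by exists 1; [exact: denom1 | rewrite mul0r].
- move=> _ _ [a Ia [s As <-]] [b Ib [t At <-]].
  have s0 := denom_neq0 As; have t0 := denom_neq0 At.
  exists (t * a + s * b).
    apply: (idealD iI); first exact: (idealM iI At.1 Ia).
    exact: (idealM iI As.1 Ib).
  by exists (s * t); [exact: denomM | field; rewrite s0 t0].
- move=> _ _ [a Aa [s As <-]] [b Ib [t At <-]].
  have s0 := denom_neq0 As; have t0 := denom_neq0 At.
  exists (a * b); first exact: idealM iI _ _ Aa Ib.
  by exists (s * t); [exact: denomM | field; rewrite s0 t0].
Qed.

(** A fraction outside the extended ideal has its numerator outside [P], so it can be inverted by
    swapping numerator and denominator. *)
Lemma localization_local : local_ring L (ideal_gen L P).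
Proof.
have PL : P `<=` L by move=> x Px; exact/sub_localization/(ideal_sub iP).
split=> //; first exact: ideal_gen_ideal.
  rewrite ideal_gen_extension // => -[a Pa [s As as1]].
  by apply: As.2; rewrite -[s]mul1r -as1 divfK // denom_neq0.
move=> _ [a Aa [s As <-]] nm; exists s; first exact: As.1.
exists a; last by rewrite invf_div.
split=> // Pa; apply: nm; rewrite ideal_gen_extension //.
by exists a => //; exists s.
Qed.

(** Every element of [I] is an element of its contraction to [A] divided by a denominator, so
    generators of the contraction generate [I]. *)
Lemma localization_noetherian : is_noetherian A -> is_noetherian L.
Proof.
move=> nA I iI; have [s sI] := nA _ (ideal_contract sA sub_localization iI).
have sIA : [set` s] `<=` I `&` A by rewrite sI; exact: sub_ideal_gen.
have iG : is_ideal L (ideal_gen L [set` s]).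
  by apply: ideal_gen_ideal => // x /sIA[_ /sub_localization].
exists s; apply/seteqP; split; last first.
  by apply: ideal_gen_min => // x /sIA[].
move=> x Ix; have [a Aa [t At xe]] := ideal_sub iI Ix.
have : (I `&` A) a.
  split=> //; rewrite -(divfK (denom_neq0 At) a) xe mulrC.
  by apply: (idealM iI) => //; exact: sub_localization At.1.
have iGA := ideal_contract sA sub_localization iG.
rewrite sI => /(ideal_gen_min iGA) Ga; rewrite -xe mulrC.
apply: (idealM iG (denom_inv At)); apply: (Ga _).1 => y sy.
by split; [exact: sub_ideal_gen | exact: (sIA _ sy).2].
Qed.

Lemma common_denominator (r : seq K) : {in r, forall x, L x} ->
  exists2 t, (A `\` P) t & {in r, forall x, A (t * x)}.
Proof.
elim: r => [|x r IH] Lr; first by exists 1 => //; exact: denom1.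
have [|t At tr] := IH; first by move=> y ry; apply: Lr; rewrite inE ry orbT.
have [a Aa [s As xe]] := Lr x (mem_head _ _).
exists (s * t); first exact: denomM.
move=> y; rewrite inE => /orP[/eqP->|ry].
  rewrite -xe mulrC mulrA divfK ?denom_neq0 //.
  by apply: subringM => //; exact: At.1.
by rewrite -mulrA; apply: subringM => //; [exact: As.1 | exact: tr].
Qed.

(** Let [t] be a common denominator of the coefficients of a monic equation of [x]. Then [t * x] is
    integral over [A], hence in [A], and dividing by [t] returns to [L]. *)
Lemma localization_integrally_closed :
  integrally_closed A -> integrally_closed L.
Proof.
move=> icA x Fx [p [/monicP mp /(polyOver_subring sL) Lp px]].
have [|t At tp] := @common_denominator p.
  by move=> _ /(nthP 0)[i _ <-].
have t0 := denom_neq0 At.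
rewrite -(mulKf t0 x); apply: subringM => //; first exact: denom_inv.
apply: sub_localization; apply: icA.
  case: Fx => _ [a Aa [s As <-]] [_ [[b Ab [u Au <-]] /eqP b0] <-].
  have s0 := denom_neq0 As; have u0 := denom_neq0 Au.
  have {}b0 : b != 0 by apply: contra_neq b0 => ->; rewrite mul0r.
  exists (t * a * u).
    exact: (subringM sA (subringM sA At.1 Aa) Au.1).
  exists (b * s); last by field; rewrite b0 u0 s0.
  split; first by apply: subringM => //; exact: As.1.
  by apply/eqP; rewrite mulf_neq0.
have p0 : p != 0 by rewrite -lead_coef_eq0 mp oner_neq0.
have [n sp] : exists n, size p = n.+1.
  by exists (size p).-1; rewrite prednK // lt0n size_poly_eq0.
have pn : p`_n = 1 by rewrite -mp lead_coefE sp.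
(* The value of this polynomial at [t * x] is t^n p(x) = 0. The factor of [t] disappears exactly at
   [i = n], which keeps it monic; below that at least one [t] is left to clear the denominator. *)
exists (\poly_(i < n.+1) (t ^+ (n - i) * p`_i)); split.
- by rewrite monicE lead_coef_poly ?subnn ?mul1r ?pn ?oner_neq0.
- apply/polyOver_subring => // i; rewrite coef_poly.
  case: ltnP => [|_]; last exact: subring0.
  rewrite ltnS leq_eqVlt => /orP[/eqP->|ltin].
    by rewrite subnn mul1r pn; exact: subring1.
  have -> : (n - i = (n - i.+1).+1)%N by rewrite -subSn.
  rewrite exprSr -mulrA; apply: subringM => //.
    by apply: subringX => //; exact: At.1.
  by apply: tp; apply: mem_nth; rewrite sp ltnS ltnW.
- rewrite /root horner_poly.
  have -> : \sum_(i < n.+1) t ^+ (n - i) * p`_i * (t * x) ^+ i = t ^+ n * p.[x].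
    rewrite horner_coef sp mulr_sumr; apply: eq_bigr => i _.
    have -> : t ^+ n = t ^+ (n - i) * t ^+ i by rewrite -exprD subnK // leq_ord.
    by rewrite exprMn; ring.
  by rewrite (eqP px) mulr0.
Qed.

(** [Q] contracts to a nonzero prime of [A], which is maximal. The contraction avoids the
    denominators, so it lies in [P] and therefore equals [P]. *)
Lemma localization_prime : (forall Q, is_prime_ideal A Q -> Q <> [set 0] ->
    is_maximal_ideal A Q) ->
  forall Q, is_prime_ideal L Q -> Q <> [set 0] -> ideal_gen L P `<=` Q.
Proof.
move=> maxA Q prLQ Q0; have [iQ nQ _] := prLQ.
have nQ1 := proper_ideal1 iQ nQ.
have iQA := ideal_contract sA sub_localization iQ.
have prQ := prime_contract sA sub_localization prLQ.
have [|_ _ maxQ] := maxA _ prQ.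
  move=> QA0; apply: Q0.
  apply/seteqP; split=> [x Qx|_ ->]; last exact: ideal0 iQ.
  have [a Aa [s As xe]] := ideal_sub iQ Qx.
  have : (Q `&` A) a.
    split=> //; rewrite -(divfK (denom_neq0 As) a) xe mulrC.
    by apply: (idealM iQ) => //; exact: sub_localization As.1.
  by rewrite QA0 -xe => ->; rewrite mul0r.
apply: ideal_gen_min => //.
have QP : Q `&` A `<=` P.
  move=> s [Qs As]; apply: contrapT => nPs; apply: nQ1.
  have dAs : (A `\` P) s by [].
  rewrite -(mulVf (denom_neq0 dAs)); apply: (idealM iQ) => //; exact: denom_inv.
by have [->|/(prime_proper prP)] := maxQ _ iP QP; [move=> x [] |].
Qed.

Lemma dedekind_uniformizer : is_dedekind A -> P <> [set 0] ->
  exists p, [/\ p != 0, ideal_gen L P = [set p * y | y in L] &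
                has_valuation L (ideal_gen L P) p].
Proof.
move=> [_ nA icA maxA] P0.
have nL := localization_noetherian nA.
have icL := localization_integrally_closed icA.
have [||p p0 Pp] := local_uniformizer localization_local nL icL.
- apply: contrapT => noa; apply: P0; apply/seteqP; split=> [x Px|_ ->].
    apply: contrapT => /eqP x0; apply: noa; exists x => //.
    exact: sub_ideal_gen.
  exact: ideal0 iP.
- exact: localization_prime.
- exists p; split=> //; exact: (noetherian_valuation localization_local p0 Pp).
Qed.

(** Elements of the square of [P] have value at least 2 in [L], so they cannot generate the maximal
    ideal. Conversely, the square of a maximal ideal is the contraction of its extension to [L], so
    an element of [P] outside the square has value exactly 1. *)
Lemma ideal_gen_local_iff S : is_dedekind A -> P <> [set 0] -> S `<=` P ->
  ideal_gen L S = ideal_gen L P <-> ~ (S `<=` ideal_sqr A P).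
Proof.
move=> dA P0 SP.
have Lm := localization_local; have im := local_ideal Lm.
have PL : P `<=` L by move=> x /(ideal_sub iP)/sub_localization.
have iS : is_ideal L (ideal_gen L S) by apply: ideal_gen_ideal => // x /SP/PL.
have [p [p0 Pp _]] := dedekind_uniformizer dA P0.
have mp := uniformizer_mem Lm Pp; have Lp := ideal_sub im mp.
have iP2 : is_ideal A (ideal_sqr A P).
  apply: ideal_gen_ideal => // _ [x Px [y Py <-]].
  by apply: subringM => //; exact: ideal_sub iP _ _.
split=> [SE SP2|/existsNP[x /not_implyP[Sx nP2x]]].
  have ip2 : is_ideal L [set p ^+ 2 * y | y in L].
    by apply: principal_ideal => //; exact: subringX.
  have P2p : ideal_sqr A P `<=` [set p ^+ 2 * y | y in L] `&` A.
    apply: ideal_gen_min; first exact: ideal_contract sub_localization ip2.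
    move=> _ [x Px [y Py <-]]; split; last first.
      by apply: subringM => //; exact: ideal_sub iP _ _.
    have := sub_ideal_gen (A := L) Px; have := sub_ideal_gen (A := L) Py.
    rewrite Pp => -[v Lv <-] [u Lu <-].
    by exists (u * v); [exact: subringM | ring].
  (* The generators in [S] are all multiples of [p ^+ 2], hence so is [p], which would make [p] a
     unit. *)
  have [y Ly py] : [set p ^+ 2 * y | y in L] p.
    rewrite -SE in mp; apply: (ideal_gen_min ip2 _ mp) => x Sx.
    exact: (P2p _ (SP2 _ Sx)).1.
  apply: (local_proper Lm); suff -> : 1 = y * p by exact: idealM im _ _ Ly mp.
  by apply: (mulfI p0); rewrite mulr1 -{1}py; ring.
apply/seteqP; split; first exact: ideal_gen_setS.
have : ideal_gen L P x by apply: sub_ideal_gen; exact: SP.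
(* Writing x = py, a unit [y] lets [x] replace [p] as a generator; a nonunit [y] must put [x] in the
   square of [P]. *)
rewrite {1}Pp => -[y Ly xe]; have [my|nmy] := EM (ideal_gen L P y); last first.
  have y0 : y != 0 by apply: contra_notN nmy => /eqP->; exact: ideal0 im.
  rewrite Pp => _ [z Lz <-]; rewrite -(mulfK y0 p) xe mulrC.
  rewrite [x / y]mulrC mulrA; apply: (idealM iS); last exact: sub_ideal_gen.
  by apply: subringM => //; exact: local_unit Lm _ Ly nmy.
case: nP2x; move: my; rewrite Pp => -[_ [a Aa [s As <-]] ye].
move: mp; rewrite ideal_gen_extension // => -[b Pb [t At pe]].
have s0 := denom_neq0 As; have t0 := denom_neq0 At.
have maxP := dedekind_prime_maximal dA prP P0.
(* Clearing denominators gives s t^2 x = a b^2 with [b] in [P]. As s t^2 is invertible modulo [P],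
   say m + r s t^2 = 1, the element x = mx + r a b^2 lies in the square. *)
have [As' nPs'] := denomM As (denomM At At).
have [m [r [Pm Ar rs1]]] := maximal_bezout sA maxP As' nPs'.
rewrite -(mul1r x) -rs1 mulrDl; apply: (idealD iP2).
  by apply: sub_ideal_gen; exists m => //; exists x => //; exact: SP.
have -> : r * (s * (t * t)) * x = r * a * (b * b).
  by rewrite -xe -ye -pe; field; rewrite s0 t0.
apply: (idealM iP2); first exact: subringM.
by apply: sub_ideal_gen; exists b => //; exists b.
Qed.

End Localization.

(** * Contractions and localizations along a system of Dedekind domains *)

Section System.
Variables (D : nat -> set K) (M : set K).
Hypothesis hD : dedekind_system D.
Let U := \bigcup_n D n.
Hypothesis hM : is_maximal_ideal U M.
Let L := localization U M.
Let P j := M `&` D j.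
Let Lj j := localization (D j) (P j).

Let sD j : is_subring (D j).
Proof. exact: dedekind_subring (system_dedekind hD j). Qed.

Lemma system_le i j : (i <= j)%N -> D i `<=` D j.
Proof.
move=> /subnK <-; elim: (j - i)%N => [|k IH] //.
by rewrite addSn => x /IH; exact: (system_chain hD _).1.
Qed.

Let DU j : D j `<=` U.
Proof. by move=> x Dx; exists j. Qed.

Lemma system_union_subring : is_subring U.
Proof.
split=> [|x y|x y]; rewrite ?in_setE.
  by exists 0%N => //; exact: subring1.
all: move=> [i _ Dx] [j _ Dy]; exists (maxn i j) => //.
all: have {}Dx := system_le (leq_maxl i j) Dx.
all: have {}Dy := system_le (leq_maxr i j) Dy.
- exact: subringB.
- exact: subringM.
Qed.

Let sU := system_union_subring.
Let prM := maximal_prime sU hM.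

Lemma system_prime j : is_prime_ideal (D j) (P j).
Proof. exact: prime_contract (DU (j := j)) prM. Qed.

(* Survival in every [D j] keeps a maximal ideal of [D 0] proper in [U], so [U]
   is not a field. *)
Lemma system_maximal_neq0 : M <> [set 0].
Proof.
move=> M0; have [_ Uinv] : is_subfield U.
  by apply: maximal0_subfield => //; rewrite -M0.
have dD := system_dedekind hD 0.
have [||Q [iQ nQ] maxQ] :=
  @noetherian_max (D 0%N) [set I | is_ideal (D 0%N) I /\ I <> D 0%N]
    (dedekind_noetherian dD).
- by move=> I [].
- exists [set 0]; split; first exact: zero_ideal.
  by move=> D0; have := subring1 (sD 0); rewrite -D0 => /eqP; rewrite oner_eq0.
have mQ : is_maximal_ideal (D 0%N) Q.
  split=> // I iI QI; have [->|nI] := EM (I = D 0%N); [by right | left].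
  exact: maxQ.
have [x Qx x0] : exists2 x, Q x & x != 0.
  apply: contrapT => nox; apply: (system_not_field hD (j := 0)).
  apply: maximal0_subfield => //; suff <- : Q = [set 0] by [].
  apply/seteqP; split=> [x Qx|_ ->]; last exact: ideal0 iQ.
  by apply: contrapT => /eqP x0; apply: nox; exists x.
have Dx := ideal_sub iQ Qx.
have [j _ Djx] := Uinv x (DU Dx) x0.
(* Survival is only given for strictly larger indices and [j] may be 0, so the contradiction is
   reached in [D j.+1]. *)
have QD : Q `<=` D j.+1 by move=> y /(ideal_sub iQ); exact: system_le.
have iG := ideal_gen_ideal (sD j.+1) QD.
apply: (system_survive hD (ltn0Sn j) mQ); apply: ideal_unit => //.
rewrite -(mulVf x0); apply: (idealM iG); last exact: sub_ideal_gen.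
exact: system_le (leqnSn j) _ Djx.
Qed.

(** A nonzero element of [M] lies in some [D i], so [P i] is maximal there and contracts to a
    maximal ideal of [D 0]. That contraction lies in [P j]; were [P j] zero, [D 0] would be a
    field. *)
Lemma system_prime_neq0 j : P j <> [set 0].
Proof.
have [x Mx x0] : exists2 x, M x & x != 0.
  apply: contrapT => nox; apply: system_maximal_neq0.
  apply/seteqP; split=> [x Mx|_ ->]; last exact: ideal0 (maximal_ideal hM).
  by apply: contrapT => /eqP x0; apply: nox; exists x.
have [i _ Dx] := ideal_sub (maximal_ideal hM) Mx.
have Pi0 : P i <> [set 0].
  move=> Pi0; have : P i x by [].
  by rewrite Pi0 => /eqP; rewrite (negPf x0).
have := dedekind_prime_maximal (system_dedekind hD i) (system_prime i) Pi0.
move=> /(system_contract hD) mP0 Pj0; apply: (system_not_field hD (j := 0)).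
apply: maximal0_subfield => //; suff <- : P i `&` D 0 = [set 0] by [].
apply/seteqP; split=> [y [[My _] D0y]|_ ->].
  by rewrite -Pj0; split=> //; exact: system_le D0y.
exact: ideal0 (maximal_ideal mP0).
Qed.

Let sLj j : is_subring (Lj j).
Proof. exact: localization_subring (system_prime j). Qed.

Let sL : is_subring L.
Proof. exact: localization_subring. Qed.

Let ML : M `<=` L.
Proof.
by move=> x /(ideal_sub (maximal_ideal hM)); exact: (sub_localization sU prM).
Qed.

Let PLj i j : (i <= j)%N -> P i `<=` Lj j.
Proof.
move=> leij x [_ Dx]; apply: (sub_localization (sD j) (system_prime j)).
exact: system_le Dx.
Qed.

Let PS i j : (i <= j)%N -> P i `<=` P j.
Proof. by move=> leij x [Mx Dx]; split=> //; exact: system_le Dx. Qed.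

Let LjL j : Lj j `<=` L.
Proof.
move=> _ [a Da [s [Ds nPs] <-]]; exists a; first exact: DU Da.
by exists s => //; split; [exact: DU Ds | move=> Ms; apply: nPs].
Qed.

(** Numerator and denominator lie in a common [D j]; the index can be pushed beyond [n], where the
    stability condition applies. *)
Lemma system_localization n x : L x -> exists2 j, (n <= j)%N & Lj j x.
Proof.
move=> [a [i _ Da] [s [[k _ Ds] nMs] <-]].
exists (maxn n (maxn i k)); first exact: leq_maxl.
exists a; first by apply: system_le Da; rewrite !leq_max leqnn orbT.
exists s => //; split; last by case.
by apply: system_le Ds; rewrite !leq_max leqnn !orbT.
Qed.

(** * Equivalence of the three conditions *)

Lemma stable_iff_never_in_square n :
  stable_local_extension D M n <-> never_in_square D M n.
Proof.
by split=> h j lenj; have := h j lenj;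
  rewrite /= (ideal_gen_local_iff (sD j) (system_prime j)
    (system_dedekind hD j) (@system_prime_neq0 j) (PS lenj)).
Qed.

(** Each element of [M] lies in some [P j] with [j >= n]; stability writes it through [P n] over
    [Lj j], hence over [L]. *)
Lemma stable_ideal_gen n : stable_local_extension D M n ->
  ideal_gen L M = ideal_gen L (P n).
Proof.
move=> st; have PM : P n `<=` M by move=> x [].
apply/seteqP; split; last exact: ideal_gen_setS.
apply: ideal_gen_min; first by apply: ideal_gen_ideal => // x /PM/ML.
move=> x Mx; have [i _ Dx] := ideal_sub (maximal_ideal hM) Mx.
pose j := maxn n i.
apply: (ideal_gen_ringS (sLj j) sL (LjL (j := j)) (PLj (leq_maxl n i))).
rewrite [ideal_gen _ _](st j (leq_maxl n i)); apply: sub_ideal_gen.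
by split=> //; exact: system_le (leq_maxr n i) _ Dx.
Qed.

Lemma stable_DVR n : stable_local_extension D M n -> is_DVR L.
Proof.
move=> st.
have [p [p0 Pp _]] := dedekind_uniformizer (sD n) (system_prime n)
  (system_dedekind hD n) (@system_prime_neq0 n).
have Lm : local_ring L (ideal_gen L M) by exact: localization_local.
have Mp : ideal_gen L M = [set p * y | y in L].
  rewrite (stable_ideal_gen st).
  exact: (principal_ringS (sLj n) sL (LjL (j := n)) (PLj (leqnn n)) Pp).
apply: (valuation_DVR Lm p0 Mp) => x Lx x0.
have [j lenj Ljx] := system_localization n Lx.
have dD := system_dedekind hD j.
have LnLj : Lj n `<=` Lj j.
  move=> _ [a Da [s [Ds nPs] <-]]; exists a; first exact: system_le Da.
  exists s => //; split; first exact: system_le Ds.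
  by move=> [Ms _]; apply: nPs.
have Ljm := localization_local (sD j) (system_prime j).
(* By stability, the uniformizer [p] of [Lj n] also serves in [Lj j], so the factorization of [x]
   uses the same [p] for every [j]. *)
have Pjp : ideal_gen (Lj j) (P j) = [set p * y | y in Lj j].
  rewrite -[LHS](st j lenj).
  exact: (principal_ringS (sLj n) (sLj j) LnLj (PLj (leqnn n)) Pp).
have [||k [u [Lu nmu xe]]] := noetherian_valuation Ljm p0 Pjp _ _ Ljx x0.
- exact: (localization_noetherian (sD j) (system_prime j)
    (dedekind_noetherian dD)).
- exact: (localization_integrally_closed (sD j) (system_prime j)
    (dedekind_integrally_closed dD)).
have u0 : u != 0.
  by apply: contra_notN nmu => /eqP->; exact: ideal0 (local_ideal Ljm).
exists k, u; split=> //; first exact: LjL Lu.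
(* The inverse of [u] in [Lj j] is also in [L], so [u] remains a unit there. *)
move=> mu; apply: (local_nonunit Lm mu u0); apply: LjL.
exact: local_unit Ljm _ Lu nmu.
Qed.

Lemma DVR_stable : is_DVR L -> exists n, stable_local_extension D M n.
Proof.
move=> [[_ pid] _].
have Lm : local_ring L (ideal_gen L M) by exact: localization_local.
have im := local_ideal Lm; have iM := maximal_ideal hM.
have [q Lq] := pid _ im; rewrite ideal_gen1 // => Mq.
have : ideal_gen L M q.
  by rewrite Mq; exists 1; [exact: subring1 | rewrite mulr1].
rewrite ideal_gen_extension // => -[m Mm [s Us qe]].
(* The generator is [m / s] with [s] a unit of [L], so [m] generates as well; any index whose ring
   contains [m] will do. *)
have [n _ Dm] := ideal_sub iM Mm.
have Mdiv x : M x -> L (x / m).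
  move=> /(sub_ideal_gen (A := L)); rewrite Mq -qe => -[y Ly <-].
  (* That [m] is nonzero is shown only afterwards; for [m = 0] the quotient is 0 by the convention
     for inverting 0. *)
  have [->|m0] := eqVneq m 0; first by rewrite invr0 mulr0; exact: subring0.
  have s0 := denom_neq0 prM Us.
  have -> : m / s * y / m = s^-1 * y by field; rewrite s0 m0.
  by apply: subringM => //; exact: denom_inv Us.
have m0 : m != 0.
  apply/eqP => m0; apply: system_maximal_neq0; apply/seteqP; split.
    move=> x /(sub_ideal_gen (A := L)); rewrite Mq -qe => -[y _ <-].
    by rewrite m0 !mul0r.
  by move=> _ ->; exact: ideal0 iM.
exists n => j lenj /=; apply/seteqP; split.
  exact: ideal_gen_setS (sLj j) (PS lenj) (PLj (leqnn j)).
have iG := ideal_gen_ideal (sLj j) (PLj lenj).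
have Ljm := localization_local (sD j) (system_prime j).
apply: ideal_gen_min => // x [Mx Dx].
have [->|x0] := eqVneq x 0; first exact: ideal0 iG.
have [p [p0 Pp vp]] := dedekind_uniformizer (sD j) (system_prime j)
  (system_dedekind hD j) (@system_prime_neq0 j).
have Ljx : Lj j x by apply: PLj (leqnn j) _ _.
have Ljm' : Lj j m by apply: PLj lenj _ _.
(* Either [x / m] is in [Lj j], so [x] is a multiple of [m] there, or [m / x] is a nonunit of [Lj j]
   and hence of [L], against [x / m] being in [L]. *)
case: (valuation_total Ljm p0 Pp vp Ljx Ljm' m0) => [Lxm|mx].
  rewrite -(divfK m0 x); apply: (idealM iG) => //.
  exact: sub_ideal_gen.
exfalso; apply: (local_nonunit Lm (x := m / x)).
- have PM : P j `<=` M by move=> y [].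
  apply: (ideal_gen_setS sL PM ML).
  exact: (ideal_gen_ringS (sLj j) sL (LjL (j := j)) (PLj (leqnn j)) mx).
- by rewrite mulf_neq0 // invr_eq0.
- by rewrite invf_div; exact: Mdiv.
Qed.

End System.
End Subrings.

Theorem corollary2p7 (K : fieldType) (D : nat -> set K) (M : set K)
    (U := \bigcup_n D n) (hD : dedekind_system D)
    (hM : is_maximal_ideal U M) :
  [<-> is_DVR (localization U M);
       exists n, stable_local_extension D M n;
       exists n, never_in_square D M n]
  /\ (forall n, stable_local_extension D M n \/ never_in_square D M n ->
        ideal_gen (localization U M) M =
        ideal_gen (localization U M) (M `&` D n)).
Proof.
split.
  tfae.
  - exact: DVR_stable.
  - by move=> [n /(stable_iff_never_in_square hD hM)]; exists n.
  - by move=> [n /(stable_iff_never_in_square hD hM)]; exact: stable_DVR.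
move=> n [st|/(stable_iff_never_in_square hD hM) st]; exact: stable_ideal_gen.
Qed.
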